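(* Let $\mathcal{B}=\langle a,b\mid ab=1\rangle$ be the bicyclic monoid. The map $R:\mathcal{B}\to \mathcal{U}_2\subset M_2(\mathbb{T})$ given by $$R(b^ia^j)=\begin{pmatrix} i-j & i+j\\ -\infty & j-i\end{pmatrix},\qquad i,j\in\mathbb{Z}_{\ge 0},$$ is a faithful tropical linear representation of $\mathcal{B}$.
   Context: The tropical semiring is $\mathbb{T}=\mathbb{R}\cup\{-\infty\}$ with addition $a\oplus b=\max\{a,b\}$ and multiplication $a\odot b=a+b$ (with $-\infty$ absorbing for $\odot$). $M_2(\mathbb{T})$ is the semigroup of $2\times 2$ matrices over $\mathbb{T}$ with matrix multiplication induced by $\oplus,\odot$. $\mathcal{U}_2$ denotes the subsemigroup of $M_2(\mathbb{T})$ generated by the upper triangular matrices $A=\begin{pmatrix} -1&1\\ -\infty&1\end{pmatrix}$ and $B=\begin{pmatrix} 1&1\\ -\infty&-1\end{pmatrix}$ (ordinary real numbers as entries). Every element of $\mathcal{B}$ has a unique expression $b^ia^j$ with $i,j\in\mathbb{Z}_{\ge0}$, where $a^0=b^0=1$. A finite dimensional tropical linear representation of a semigroup $\mathcal{M}$ is a semigroup homomorphism from $\mathcal{M}$ to the semigroup of tropical linear operators on $\mathbb{T}^{n}$, identified with $M_n(\mathbb{T})$ (it is not required to send an identity element to the identity matrix); it is faithful if it is one-to-one. *)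

(* Defs.v *)
From HB Require Import structures.
From mathcomp Require Import all_boot all_order all_algebra.
From mathcomp Require Import boolp reals.

Set Implicit Arguments.
Unset Strict Implicit.
Unset Printing Implicit Defensive.

Import Order.TTheory GRing.Theory Num.Theory.
Local Open Scope ring_scope.

(* [None] is -oo. In the semiring structure below [+] is max and [*] is the   *)
(* ordinary addition, so that [0 : tropical R] is -oo and [1 : tropical R] is *)
(* the real number 0.                                                         *)
Definition tropical (R : realDomainType) : Type := option R.

Definition trop_fin {R : realDomainType} (x : R) : tropical R := Some x.
Definition trop_ninfty {R : realDomainType} : tropical R := None.

Section TropicalSemiring.
Variable R : realDomainType.
Implicit Types x y z : tropical R.

HB.instance Definition _ := Choice.on (tropical R).

Definition trop_add x y : tropical R :=
  match x, y with
  | Some a, Some b => Some (Num.max a b)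
  | None, _ => y
  | _, None => x
  end.

Definition trop_mul x y : tropical R :=
  match x, y with
  | Some a, Some b => Some (a + b)
  | _, _ => None
  end.

Fact trop_addA : associative trop_add.
Proof. by move=> [a|] [b|] [c|] //=; rewrite maxA. Qed.

Fact trop_addC : commutative trop_add.
Proof. by move=> [a|] [b|] //=; rewrite maxC. Qed.

Fact trop_add0 : left_id trop_ninfty trop_add.
Proof. by case. Qed.

Fact trop_mulA : associative trop_mul.
Proof. by move=> [a|] [b|] [c|] //=; rewrite addrA. Qed.

Fact trop_mulC : commutative trop_mul.
Proof. by move=> [a|] [b|] //=; rewrite addrC. Qed.

Fact trop_mul1 : left_id (trop_fin 0) trop_mul.
Proof. by case=> [a|] //=; rewrite add0r. Qed.

Fact trop_mulDl : left_distributive trop_mul trop_add.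
Proof. by move=> [a|] [b|] [c|] //=; rewrite addr_maxl. Qed.

Fact trop_mul0 : left_zero trop_ninfty trop_mul.
Proof. by []. Qed.

Fact trop_1neq0 : trop_fin 0 != trop_ninfty.
Proof. by []. Qed.

HB.instance Definition _ :=
  GRing.isNmodule.Build (tropical R) trop_addA trop_addC trop_add0.

HB.instance Definition _ := GRing.Nmodule_isComNzSemiRing.Build (tropical R)
  trop_mulA trop_mulC trop_mul1 trop_mulDl trop_mul0 trop_1neq0.

End TropicalSemiring.

(* An alias of the matrix type, because matrices over some coefficient types  *)
(* already carry an additive group law in [group_scope].                      *)
Definition tropmx (R : realDomainType) (n : nat) : Type := 'M[tropical R]_n.

HB.instance Definition _ (R : realDomainType) (n : nat) :=
  Choice.on (tropmx R n).

HB.instance Definition _ (R : realDomainType) (n : nat) :=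
  isSemigroup.Build (tropmx R n) (@mulmxA (tropical R) n n n n).

Definition mx22 {R : realDomainType} (x y z t : tropical R) : tropmx R 2 :=
  \matrix_(k < 2, l < 2)
    if val k == 0%N then (if val l == 0%N then x else y)
                    else (if val l == 0%N then z else t).

Definition trop_representation (R : realDomainType) (G : semigroupType)
    (n : nat) (rho : G -> tropmx R n) : Prop :=
  {morph rho : x y / (x * y)%g}.

Definition faithful_trop_representation (R : realDomainType)
    (G : semigroupType) (n : nat) (rho : G -> tropmx R n) : Prop :=
  trop_representation rho /\ injective rho.

Inductive subsemigroup_gen (G : semigroupType) (S : G -> Prop) : G -> Prop :=
| subsemigroup_gen_in x : S x -> subsemigroup_gen S x
| subsemigroup_gen_mul x y :
    subsemigroup_gen S x -> subsemigroup_gen S y ->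
    subsemigroup_gen S (x * y)%g.

Definition U2_A {R : realDomainType} : tropmx R 2 :=
  mx22 (trop_fin (- 1)) (trop_fin 1)
       trop_ninfty      (trop_fin 1).

Definition U2_B {R : realDomainType} : tropmx R 2 :=
  mx22 (trop_fin 1) (trop_fin 1)
       trop_ninfty  (trop_fin (- 1)).

Definition U2 {R : realDomainType} : tropmx R 2 -> Prop :=
  subsemigroup_gen (fun M => M = U2_A \/ M = U2_B).

(* The monoid < X | rels >: words over X modulo the least congruence          *)
(* containing rels.                                                           *)
Section Presentation.
Variables (X : choiceType) (rels : seq (seq X * seq X)).

Inductive pres_cong : seq X -> seq X -> Prop :=
| pres_cong_rel u v : (u, v) \in rels -> pres_cong u v
| pres_cong_refl u : pres_cong u u
| pres_cong_sym u v : pres_cong u v -> pres_cong v u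
| pres_cong_trans u v w : pres_cong u v -> pres_cong v w -> pres_cong u w
| pres_cong_cat u u' v v' :
    pres_cong u u' -> pres_cong v v' -> pres_cong (u ++ v) (u' ++ v').

Definition pres_equiv : rel (seq X) := fun u v => `[< pres_cong u v >].

Fact pres_equiv_refl : reflexive pres_equiv.
Proof. by move=> u; apply/asboolP; exact: pres_cong_refl. Qed.

Fact pres_equiv_sym : symmetric pres_equiv.
Proof. by move=> u v; apply/asboolP/asboolP => h; exact: pres_cong_sym. Qed.

Fact pres_equiv_trans : transitive pres_equiv.
Proof.
move=> v u w /asboolP uv /asboolP vw; apply/asboolP.
exact: pres_cong_trans uv vw.
Qed.

Canonical pres_equiv_equiv :=
  EquivRel pres_equiv pres_equiv_refl pres_equiv_sym pres_equiv_trans.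

Local Open Scope quotient_scope.

Definition presented : Type := {eq_quot pres_equiv}.

HB.instance Definition _ := Choice.on presented.
HB.instance Definition _ := EqQuotient.on presented.

Definition presented_class (u : seq X) : presented := \pi_presented u.

Lemma presented_classP u v :
  presented_class u = presented_class v <-> pres_cong u v.
Proof.
split=> [/eqP|uv]; first by rewrite piE => /asboolP.
by apply/eqP; rewrite piE; apply/asboolP.
Qed.

Definition presented_mul (x y : presented) : presented :=
  presented_class (repr x ++ repr y).

Lemma presented_mulE u v :
  presented_mul (presented_class u) (presented_class v) =
  presented_class (u ++ v).
Proof.
by apply/presented_classP/pres_cong_cat; apply/presented_classP;
  rewrite /presented_class reprK.
Qed.

Lemma presented_classK (x : presented) : presented_class (repr x) = x.
Proof. exact: reprK. Qed.

Fact presented_mulA : associative presented_mul.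
Proof.
move=> x y z.
rewrite -(presented_classK x) -(presented_classK y) -(presented_classK z).
by rewrite !presented_mulE catA.
Qed.

Fact presented_mul1 : left_id (presented_class [::]) presented_mul.
Proof. by move=> x; rewrite -(presented_classK x) presented_mulE. Qed.

Fact presented_1mul : right_id (presented_class [::]) presented_mul.
Proof. by move=> x; rewrite -(presented_classK x) presented_mulE cats0. Qed.

HB.instance Definition _ := isMonoid.Build presented
  presented_mulA presented_mul1 presented_1mul.

Definition presented_gen (x : X) : presented := presented_class [:: x].

End Presentation.

(* The letters a and b are encoded as [true] and [false]. *)
Definition bicyclic : Type :=
  presented [:: ([:: true; false], [::] : seq bool)].

HB.instance Definition _ := Monoid.on bicyclic.

Definition bicyclic_a : bicyclic := presented_gen _ true.
Definition bicyclic_b : bicyclic := presented_gen _ false.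

(* Main.v *)
Require Import Defs.
From HB Require Import structures.
From mathcomp Require Import all_boot all_order all_algebra.
From mathcomp Require Import boolp reals.
From mathcomp Require Import lra.

(** Write [T i j] for the matrix that the theorem attaches to [b^i a^j].  The
    product of [T i j] and [T k l] has diagonal [i - j + k - l] and its
    opposite, and its corner is
    [max (i - j + k + l, i + j + l - k) = i + l + |j - k|].  With truncated
    subtraction it is therefore [T (i + (k - j)) (l + (j - k))]
    ([bicyclic_mxM]), which is how normal forms multiply in the bicyclic
    monoid: in [b^i a^j b^k a^l] the middle letters cancel in pairs [a b] until
    one kind is exhausted.

    The representation is built on words, by multiplying the matrices [A] and
    [B] of the letters, starting from the idempotent [T 0 0 = A B].  This
    idempotent is not the identity matrix, but it acts as one on every [T i j].
    Induction on a word [w] gives exponents [i], [j] such that [w] is congruent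
    to [b^i a^j] and has matrix [T i j] ([word_mx_normal_form]).  Since
    [A B = T 0 0], the matrix of a word depends only on its class, so it
    defines a morphism on the monoid; its values are products of [A]'s and
    [B]'s.  Finally [T i j] determines [i - j] and [i + j], hence [i] and [j],
    so the normal form of an element is recovered from its matrix: this is
    faithfulness.  Uniqueness of the map holds because every element has the
    form [b^i a^j]. *)

Set Implicit Arguments.
Unset Strict Implicit.
Unset Printing Implicit Defensive.

Import Order.TTheory GRing.Theory Num.Theory.
Local Open Scope ring_scope.

(** * Upper triangular tropical matrices *)

Section Matrices.
Variable R : realDomainType.
Implicit Types (i j k l : nat) (u v w : seq bool).

Lemma mx22_triM (x y z x' y' z' : R) :
  (mx22 (trop_fin x) (trop_fin y) trop_ninfty (trop_fin z) *
   mx22 (trop_fin x') (trop_fin y') trop_ninfty (trop_fin z'))%g =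
  mx22 (trop_fin (x + x')) (trop_fin (Num.max (x + y') (y + z')))
       trop_ninfty         (trop_fin (z + z')).
Proof.
apply/matrixP => p q.
rewrite mxE !big_ord_recl big_ord0 !mxE /=.
by case: p => [[|[|p]] //= _]; case: q => [[|[|q]] //= _].
Qed.

Definition bicyclic_mx i j : tropmx R 2 :=
  mx22 (trop_fin (i%:R - j%:R)) (trop_fin (i%:R + j%:R))
       trop_ninfty              (trop_fin (j%:R - i%:R)).

(** The comparison of [j] and [k] decides which of the two terms of the maximum
    is the larger one, and also which truncated difference vanishes. *)
Lemma bicyclic_mxM i j k l :
  (bicyclic_mx i j * bicyclic_mx k l)%g =
  bicyclic_mx (i + (k - j)) (l + (j - k)).
Proof.
rewrite mx22_triM /bicyclic_mx !natrD.
have [le_jk|/ltnW le_kj] := leqP j k.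
- have jk : (j%:R : R) <= k%:R by rewrite ler_nat.
  rewrite (eqP le_jk) natrB // max_l; last by lra.
  by congr mx22; congr trop_fin; lra.
- have kj : (k%:R : R) <= j%:R by rewrite ler_nat.
  rewrite (eqP le_kj) natrB // max_r; last by lra.
  by congr mx22; congr trop_fin; lra.
Qed.

Lemma bicyclic_mx_inj i j k l :
  bicyclic_mx i j = bicyclic_mx k l -> i = k /\ j = l.
Proof.
move=> /matrixP eqT.
have := eqT ord0 ord0; have := eqT ord0 (lift ord0 ord0).
rewrite !mxE /= => -[sumE] [diffE].
by split; apply/eqP; rewrite -(eqr_nat R); apply/eqP; lra.
Qed.

Lemma bicyclic_mx_A : bicyclic_mx 0 1 = U2_A.
Proof. by congr mx22; congr trop_fin; lra. Qed.

Lemma bicyclic_mx_B : bicyclic_mx 1 0 = U2_B.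
Proof. by congr mx22; congr trop_fin; lra. Qed.

(** * The matrix of a word *)

Definition letter_mx (c : bool) : tropmx R 2 :=
  if c then bicyclic_mx 0 1 else bicyclic_mx 1 0.

(** The empty word goes to the idempotent [bicyclic_mx 0 0], which is not the
    identity matrix: its corner is [0] instead of [-oo]. *)
Definition word_mx w : tropmx R 2 :=
  foldr (fun c M => (letter_mx c * M)%g) (bicyclic_mx 0 0) w.

Local Notation cong :=
  (pres_cong [:: ([:: true; false], [::] : seq bool)]).

Definition normal_word i j : seq bool := nseq i false ++ nseq j true.

(** The matrix and the normal form are read off together, because a letter
    put in front changes the exponents in the same way on both sides.  The one
    case where a relation is applied is an [a] in front of [b^i] with
    [0 < i]. *)
Lemma word_mx_normal_form w :
  exists i j, cong w (normal_word i j) /\ word_mx w = bicyclic_mx i j.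
Proof.
elim: w => [|c w [i [j [cw mw]]]].
  by exists 0, 0; split; first exact: pres_cong_refl.
have cons_cong : cong (c :: w) (c :: normal_word i j).
  exact: (pres_cong_cat (pres_cong_refl _ [:: c]) cw).
rewrite /= mw; case: c cons_cong => cons_cong /=; last first.
  exists i.+1, j; split=> //.
  by rewrite bicyclic_mxM subn0 addn0.
case: i cons_cong {cw mw} => [|i] cons_cong.
  exists 0, j.+1; split=> //.
  by rewrite bicyclic_mxM addn1.
exists i, j; split; last by rewrite bicyclic_mxM subn1 addn0.
apply: pres_cong_trans cons_cong _.
apply: (@pres_cong_cat _ _ [:: true; false] [::] _ (normal_word i j)).
  by apply: pres_cong_rel; rewrite mem_head.
exact: pres_cong_refl.
Qed.

(** The matrix of [u ++ v] ends with one copy of [bicyclic_mx 0 0] and the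
    product of matrices contains two.  The extra one is absorbed by [word_mx v],
    since that matrix is some [bicyclic_mx i j]. *)
Lemma word_mx_cat u v : word_mx (u ++ v) = (word_mx u * word_mx v)%g.
Proof.
elim: u => [|c u IHu] /=; last by rewrite IHu mulgA.
have [i [j [_ ->]]] := word_mx_normal_form v.
by rewrite bicyclic_mxM subn0 addn0.
Qed.

(** This is where the defining relation is used: [A B] is the matrix of the
    empty word, because the idempotent was chosen as [A B]. *)
Lemma word_mx_cong u v : cong u v -> word_mx u = word_mx v.
Proof.
elim=> {u v} [u v||u v _ ->|u v w _ -> _ ->|u u' v v' _ Hu _ Hv] //.
- by rewrite inE => /eqP [-> ->] /=; rewrite !bicyclic_mxM.
- by rewrite !word_mx_cat Hu Hv.
Qed.

Lemma word_mx_normal i j : word_mx (normal_word i j) = bicyclic_mx i j.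
Proof.
elim: i => [|i IHi]; last first.
  by rewrite /= IHi bicyclic_mxM subn0 addn0.
elim: j => [|j IHj] //.
rewrite -[LHS]/(letter_mx true * word_mx (normal_word 0 j))%g IHj.
by rewrite bicyclic_mxM addn1.
Qed.

Lemma word_mx_U2 w : U2 (word_mx w).
Proof.
have letterU2 c : U2 (letter_mx c).
  by apply: subsemigroup_gen_in; case: c;
    [left; exact: bicyclic_mx_A | right; exact: bicyclic_mx_B].
elim: w => [|c w IHw] /=; last exact: subsemigroup_gen_mul (letterU2 c) IHw.
have -> : bicyclic_mx 0 0 = (letter_mx true * letter_mx false)%g.
  by rewrite bicyclic_mxM.
exact: subsemigroup_gen_mul (letterU2 true) (letterU2 false).
Qed.

(** * The representation of the bicyclic monoid *)

Definition bicyclic_class (w : seq bool) : bicyclic := presented_class _ w.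

Lemma bicyclic_class_normal i j :
  bicyclic_class (normal_word i j) = (bicyclic_b ^+ i * bicyclic_a ^+ j)%g.
Proof.
have gen_exp c n :
    bicyclic_class (nseq n c) = ((presented_gen _ c : bicyclic) ^+ n)%g.
  elim: n => [|n IHn]; first by rewrite expg0.
  by rewrite expgS -IHn; symmetry; exact: presented_mulE.
by rewrite -!gen_exp; symmetry; exact: presented_mulE.
Qed.

Lemma bicyclic_normal_form (x : bicyclic) :
  exists i j, x = (bicyclic_b ^+ i * bicyclic_a ^+ j)%g.
Proof.
rewrite -(presented_classK x).
have [i [j [cx _]]] := word_mx_normal_form (repr x).
by exists i, j; rewrite -bicyclic_class_normal; apply/presented_classP.
Qed.

Definition bicyclic_rep (x : bicyclic) : tropmx R 2 := word_mx (repr x).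

Lemma bicyclic_rep_class w : bicyclic_rep (bicyclic_class w) = word_mx w.
Proof.
by apply: word_mx_cong; apply/presented_classP; exact: presented_classK.
Qed.

Lemma bicyclic_rep_normal i j :
  bicyclic_rep (bicyclic_b ^+ i * bicyclic_a ^+ j)%g = bicyclic_mx i j.
Proof. by rewrite -bicyclic_class_normal bicyclic_rep_class word_mx_normal. Qed.

Lemma bicyclic_repM : trop_representation bicyclic_rep.
Proof.
by move=> x y; rewrite [LHS]bicyclic_rep_class word_mx_cat.
Qed.

Lemma bicyclic_rep_inj : injective bicyclic_rep.
Proof.
move=> x y.
have [i [j ->]] := bicyclic_normal_form x.
have [k [l ->]] := bicyclic_normal_form y.
by rewrite !bicyclic_rep_normal => /bicyclic_mx_inj [-> ->].
Qed.

End Matrices.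

Unset Implicit Arguments.

Theorem theorem4p4 (R : realType) :
  exists2 rho : bicyclic -> tropmx R 2,
    unique
      (fun f : bicyclic -> tropmx R 2 =>
         forall i j : nat,
           f (bicyclic_b ^+ i * bicyclic_a ^+ j)%g =
           mx22 (trop_fin (i%:R - j%:R)) (trop_fin (i%:R + j%:R))
                trop_ninfty              (trop_fin (j%:R - i%:R)))
      rho
    & (forall x : bicyclic, U2 (rho x)) /\ faithful_trop_representation rho.
Proof.
exists (@bicyclic_rep R); last first.
  split; first by move=> x; exact: word_mx_U2.
  by split; [exact: bicyclic_repM | exact: bicyclic_rep_inj].
split=> [|f fE]; first exact: bicyclic_rep_normal.
apply/funext => x; have [i [j ->]] := bicyclic_normal_form R x.
by rewrite fE bicyclic_rep_normal.
Qed.
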